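(* Let $H\ge1$, $s\ge1$ be integers, $\Psi$ a positive integer with $\Psi/s^H\in\mathbb{Z}^+$, $q>0$, $\rho\in(0,1]$, and $w_1,\dots,w_s$ fixed real numbers. Let $\{X^{(j)}_{i_1,\dots,i_H}: i_1,\dots,i_H\in\{1,\dots,s\},\ j\ge1\}$ be independent $N(0,1)$ random variables. Let $t_{i_1,\dots,i_H}\in\mathbb{Z}_{\ge0}$ be nonnegative integers with $\sum_{i_1,\dots,i_H=1}^s t_{i_1,\dots,i_H}=\Psi$, and suppose the uniformity assumption holds: there is a constant $c\ge1$ such that for all $(i_1,\dots,i_H)\in\{1,\dots,s\}^H$, \[ \frac1c\cdot\frac{\Psi}{s^H}\le t_{i_1,\dots,i_H}\le c\cdot\frac{\Psi}{s^H}. \] Define \[ Y_s=q\sum_{i_1,\dots,i_H=1}^{s}\sum_{j=1}^{t_{i_1,\dots,i_H}}X^{(j)}_{i_1,\dots,i_H}\rho\prod_{k=1}^H w_{i_k},\qquad \hat Y_s=q\sum_{i_1,\dots,i_H=1}^{s}\sum_{j=1}^{\Psi/s^H}X^{(j)}_{i_1,\dots,i_H}\rho\prod_{k=1}^H w_{i_k}. \] Then $\mathrm{corr}(\hat Y_s,Y_s)\ge \frac{1}{c^2}$.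
   Context: $\mathrm{corr}(A,B)=\frac{\mathbb{E}[(A-\mathbb{E}A)(B-\mathbb{E}B)]}{\mathrm{std}(A)\,\mathrm{std}(B)}$. In the paper's setting, $Y_s$ is the expected output of a network whose weights take $s$ distinct values $w_1,\dots,w_s$, $t_{i_1,\dots,i_H}$ is the number of input-to-output paths whose ordered weight sequence is $(w_{i_1},\dots,w_{i_H})$, $\Psi$ is the total number of paths, and both $Y_s$ and $\hat Y_s$ are built from the same family of Gaussian variables $X^{(j)}_{i_1,\dots,i_H}$.
   Formalization: It is additionally assumed that at least one of the weights w_1,…,w_s is nonzero; if all are zero then both outputs vanish identically and the correlation is the undefined quotient 0/0. *)

(* Defs.v *)
From HB Require Import structures.
From mathcomp Require Import all_boot all_order all_algebra.
From mathcomp Require Import all_classical all_reals all_analysis.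
Set Implicit Arguments. Unset Strict Implicit. Unset Printing Implicit Defensive.
Import Order.TTheory GRing.Theory Num.Theory.
Local Open Scope classical_set_scope.
Local Open Scope ring_scope.

(* Mutual independence of a family of real random variables, stated as the
   product rule over every finite duplicate-free subfamily and every choice
   of Borel sets (probabilities are finite, so [fine] loses nothing). *)
Definition mutually_independent {d} {T : measurableType d} {R : realType}
    (P : probability T R) {I : eqType} (X : I -> {RV P >-> R}) : Prop :=
  forall (F : seq I) (B : I -> set R),
    uniq F ->
    (forall i, measurable (B i)) ->
    fine (P (\bigcap_(i in [set` F]) (X i @^-1` B i))) =
    \prod_(i <- F) fine (P (X i @^-1` B i)).

Definition std_normal_RV {d} {T : measurableType d} {R : realType}
    (P : probability T R) (X : {RV P >-> R}) : Prop :=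
  forall A : set R, measurable A ->
    distribution P X A = normal_prob (0 : R) 1 A.

Definition corr {d} {T : measurableType d} {R : realType}
    (P : probability T R) (A B : T -> R) : R :=
  fine (covariance P A B) /
    (Num.sqrt (fine ('V_P[A])%E) * Num.sqrt (fine ('V_P[B])%E)).

Definition Yout {d} {T : measurableType d} {R : realType}
    (P : probability T R) (H s : nat)
    (X : {ffun 'I_H -> 'I_s} * nat -> {RV P >-> R})
    (q rho : R) (w : 'I_s -> R) (n : {ffun 'I_H -> 'I_s} -> nat) : T -> R :=
  fun om => q * \sum_(a : {ffun 'I_H -> 'I_s}) \sum_(j < n a)
              X (a, val j) om * rho * \prod_(k < H) w (a k).

Arguments mutually_independent {d T R} P {I} X.
Arguments std_normal_RV {d T R} P X.
Arguments corr {d T R} P A B.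
Arguments Yout {d T R} P {H s} X q rho w n _.

(* Main.v *)
(** Each output is a linear combination of the [X^(j)_i], which are pairwise
    uncorrelated with a common variance [V]. With [g_i = q rho prod_k w_(i_k)],
    [m = Psi / s^H] and [G = sum_i g_i^2], this gives
      [Cov(Yhat, Y) = V sum_i g_i^2 min(m, t_i) >= V m G / c],
      [Var Yhat = V m G] and [Var Y = V sum_i g_i^2 t_i <= c V m G],
    hence even [corr(Yhat, Y) >= c^(-3/2)]. The value of [V] cancels, so only
    [0 < V < +oo] is needed: the second moment of the normal law is finite, and
    the law has no atom. *)
Require Import Defs.
From HB Require Import structures.
From mathcomp Require Import all_boot all_order all_algebra.
From mathcomp Require Import all_classical all_reals all_analysis.
From mathcomp Require Import measurable_realfun ring lra.
Import Order.TTheory GRing.Theory Num.Theory.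
Local Open Scope classical_set_scope.
Local Open Scope ring_scope.

(** * Integrals against the normal law and its second moment *)

(** The Radon-Nikodym derivative of [normal_prob] and [normal_pdf] have the same integral over every
    measurable set, so they agree almost everywhere and may be exchanged under the integral. *)
Lemma ge0_integral_normal_prob (R : realType) (m s : R) (f : R -> \bar R) :
  measurable_fun setT f -> (forall x, 0 <= f x)%E ->
  (\int[normal_prob m s]_x f x =
   \int[lebesgue_measure]_x (f x * (normal_pdf m s x)%:E))%E.
Proof.
move=> mf f0.
have dom := normal_prob_dominates m s.
rewrite -(Radon_Nikodym_SigmaFinite.change_of_variables dom)//.
apply: ae_eq_integral => //.
- apply: emeasurable_funM => //.
  exact: measurable_int (Radon_Nikodym_SigmaFinite.f_integrable dom).
- apply: emeasurable_funM => //; apply/measurable_EFinP.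
  exact: measurable_normal_pdf.
- apply: ae_eqe_mul2l; apply: integral_ae_eq => //.
  + exact: Radon_Nikodym_SigmaFinite.f_integrable.
  + by apply/measurable_EFinP; exact: measurable_normal_pdf.
  + by move=> E _ mE; rewrite -Radon_Nikodym_SigmaFinite.f_integral.
Qed.

(* [u <= expR u] at [u = x ^+ 2 / 4]. *)
Lemma sqr_normal_pdf_le (R : realType) (x : R) :
  x ^+ 2 * normal_pdf 0 1 x <=
  4 * normal_peak 1 / normal_peak (Num.sqrt 2) * normal_pdf 0 (Num.sqrt 2) x.
Proof.
have s2 : Num.sqrt 2 != 0 :> R by rewrite gt_eqF// sqrtr_gt0.
rewrite !normal_pdfE ?oner_neq0// /normal_fun subr0 sqr_sqrtr// expr1n.
rewrite [leRHS]mulrA mulfVK; last by rewrite gt_eqF// normal_peak_gt0.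
rewrite mulrCA [leRHS]mulrAC [leRHS]mulrC ler_wpM2l ?normal_peak_ge0//.
pose u := x ^+ 2 / 4.
(* Variance 1 gives the exponent [- u - u], variance 2 only [- u]; the spare factor [expR (- u)]
   absorbs [x ^+ 2 = 4 * u]. *)
have -> : - x ^+ 2 / (1 *+ 2) = - u - u by rewrite /u; lra.
have -> : - x ^+ 2 / (2 *+ 2) = - u by rewrite /u; lra.
have -> : x ^+ 2 = 4 * u by rewrite /u; lra.
rewrite -mulrA ler_wpM2l// expRD mulrA ler_piMl ?expR_ge0// expRN.
rewrite ler_pdivrMr ?expR_gt0// mul1r.
by apply: le_trans (expR_ge1Dx u); rewrite lerDr.
Qed.

(** The integrand is dominated by a constant multiple of the density of variance 2, whose integral
    is 1. *)
Lemma normal_prob_sqr_lty (R : realType) :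
  (\int[normal_prob 0 1]_x ((x : R) ^+ 2)%:E < +oo)%E.
Proof.
rewrite ge0_integral_normal_prob; last 2 first.
- by apply/measurable_EFinP; exact: measurable_funX.
- by move=> x; rewrite lee_fin sqr_ge0.
pose C : R := 4 * normal_peak 1 / normal_peak (Num.sqrt 2).
have C0 : 0 <= C by rewrite !mulr_ge0 ?invr_ge0 ?normal_peak_ge0.
apply: (@le_lt_trans _ _ (\int[lebesgue_measure]_x
  (C%:E * (normal_pdf 0 (Num.sqrt (2 : R)) x)%:E)))%E.
  apply: ge0_le_integral => //=.
  - by move=> x _; rewrite mule_ge0// lee_fin ?sqr_ge0// normal_pdf_ge0.
  - apply: emeasurable_funM; first by apply/measurable_EFinP; exact: measurable_funX.
    by apply/measurable_EFinP; exact: measurable_normal_pdf.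
  - apply: emeasurable_funM => //.
    by apply/measurable_EFinP; exact: measurable_normal_pdf.
  - by move=> x _; rewrite -!EFinM lee_fin sqr_normal_pdf_le.
rewrite ge0_integralZl//=.
- by rewrite integral_normal_pdf mule1 ltry.
- by apply/measurable_EFinP; exact: measurable_normal_pdf.
- by move=> x _; rewrite lee_fin normal_pdf_ge0.
Qed.

Definition std_normal_var (R : realType) : R :=
  fine (\int[normal_prob 0 1]_x ((x : R) ^+ 2)%:E -
        (\int[normal_prob 0 1]_x (x : R)%:E) ^+ 2)%E.

(** * Moments of standard normal variables, and products of independent variables *)

Section moments.
Context {d} {T : measurableType d} {R : realType} (P : probability T R).
Implicit Types X Y : {RV P >-> R}.

Lemma Lfun2_of_sqr X :
  (\int[P]_w ((X w) ^+ 2)%:E < +oo)%E -> (X : T -> R) \in Lfun P 2%:E.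
Proof.
move=> Xoo; rewrite inE; apply/andP; split; rewrite inE//=.
apply: (@lty_poweRy _ _ 2) => //; rewrite poweR_Lnorm//.
by under eq_integral do rewrite /= powR_mulrn// real_normK ?num_real//.
Qed.

(* [normal_prob] is a measure on [measurableTypeR R], whose measurable structure
   is not convertible to the one of [R], although the measurable sets are the
   same; hence the integrals against the push-forward to [measurableTypeR R]. *)
Lemma measurable_funTR X : measurable_fun setT (X : T -> measurableTypeR R).
Proof. exact: (measurable_funP X). Qed.

Lemma ge0_integral_std_normal_RV X (f : R -> \bar R) :
  std_normal_RV P X -> measurable_fun setT f -> (forall x, 0 <= f x)%E ->
  (\int[P]_w f (X w) = \int[normal_prob 0 1]_x f x)%E.
Proof.
move=> nX mf f0; have mX := measurable_funTR X.
transitivity (\int[pushforward P (X : T -> measurableTypeR R)]_x f x)%E.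
  by rewrite (ge0_integral_pushforward mX).
by apply: eq_measure_integral => A mA _; exact: nX.
Qed.

Lemma std_normal_Lfun2 X : std_normal_RV P X -> (X : T -> R) \in Lfun P 2%:E.
Proof.
move=> nX; apply: Lfun2_of_sqr.
rewrite (ge0_integral_std_normal_RV _ (fun x => (x ^+ 2)%:E))//.
- exact: normal_prob_sqr_lty.
- by apply/measurable_EFinP; exact: measurable_funX.
- by move=> x; rewrite lee_fin sqr_ge0.
Qed.

Lemma expectation_std_normal X : std_normal_RV P X ->
  ('E_P[X] = \int[normal_prob 0 1]_x (x : R)%:E)%E.
Proof.
move=> nX; have X1 : (X : T -> R) \in Lfun P 1.
  by apply: Lfun_subset12; [exact: fin_num_measure|exact: std_normal_Lfun2].
rewrite expectation_def; have mX := measurable_funTR X.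
transitivity (\int[pushforward P (X : T -> measurableTypeR R)]_x (x%:E))%E.
  by rewrite (integral_pushforward mX)//; exact/Lfun1_integrable.
by apply: eq_measure_integral => A mA _; exact: nX.
Qed.

Lemma variance_std_normal X : std_normal_RV P X ->
  ('V_P[X] = (std_normal_var R)%:E)%E.
Proof.
move=> nX; have X2 := std_normal_Lfun2 X nX.
rewrite -[LHS]fineK ?variance_fin_num// varianceE// expectation_std_normal//.
rewrite /std_normal_var; congr (fine (_ - _))%:E.
rewrite -(ge0_integral_std_normal_RV X (fun x => (x ^+ 2)%:E))//.
- by rewrite unlock.
- by apply/measurable_EFinP; exact: measurable_funX.
- by move=> x; rewrite lee_fin sqr_ge0.
Qed.

(** A variable of zero variance equals its mean almost surely, so its law has an atom; the normal
    law, dominated by Lebesgue measure, gives singletons mass 0. *)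
Lemma std_normal_var_gt0 X : std_normal_RV P X -> 0 < std_normal_var R.
Proof.
move=> nX; rewrite -lte_fin -(variance_std_normal _ nX) lt_neqAle variance_ge0.
rewrite andbT; apply/eqP => V0.
set m := fine ('E_P[X])%E.
have mXm : measurable_fun setT (fun w => ((X w - m) ^+ 2)%:E).
  by apply/measurable_EFinP/measurable_funX/measurable_funB.
have /ae_eq_integral_abs : (\int[P]_w `|((X w - m) ^+ 2)%:E| = 0)%E.
  rewrite [RHS]V0 /variance unlock unlock; apply: eq_integral => w _.
  by rewrite gee0_abs ?lee_fin ?sqr_ge0// expr2 /m unlock.
move=> /(_ measurableT mXm) aeX.
have X1 : P (X @^-1` [set m]) = 1%E.
  have mS : measurable (X @^-1` [set m]).
    by rewrite -[X in measurable X]setTI; apply: measurable_funP.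
  have : P (~` (X @^-1` [set m])) = 0.
    apply/negligibleP; first exact: measurableC.
    move: aeX; apply: negligibleS => w /= Xm /(_ I) [] /eqP.
    by rewrite sqrf_eq0 subr_eq0 => /eqP.
  rewrite probability_setC// => /eqP.
  by rewrite sube_eq ?fin_num_measure// add0e => /eqP <-.
have := nX [set m] (measurable_set1 m).
rewrite /distribution /pushforward X1.
have -> : normal_prob 0 1 [set m] = 0 :> \bar R.
  have /null_content_dominatesP := normal_prob_dominates (0 : R) 1.
  by apply => //; exact: lebesgue_measure_set1.
by move/eqP; rewrite onee_eq0.
Qed.

(** Independence makes the law of the pair the product of the two laws, and Fubini then splits the
    integral of [x * y]. *)
Lemma expectationM_indep X Y :
  (forall A B, measurable A -> measurable B ->
     P (X @^-1` A `&` Y @^-1` B) = P (X @^-1` A) * P (Y @^-1` B))%E ->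
  (X : T -> R) \in Lfun P 1 -> (Y : T -> R) \in Lfun P 1 ->
  ((X : T -> R) \* Y) \in Lfun P 1 ->
  ('E_P[(X : T -> R) \* Y] = 'E_P[X] * 'E_P[Y])%E.
Proof.
move=> indep X1 Y1 XY1.
pose mu := distribution P X; pose nu := distribution P Y.
pose Z w := (X w, Y w).
have mZ : measurable_fun setT Z by exact/measurable_fun_pair.
pose f (z : R * R) : \bar R := (z.1 * z.2)%:E.
have mf : measurable_fun setT f.
  by apply/measurable_EFinP; exact: measurable_funM.
pose lam : {measure set (R * R) -> \bar R} :=
  measure_function_pushforward__canonical__measure_function_Measure P mZ.
have joint (A : set (R * R)) : measurable A -> (mu \x nu)%E A = lam A.
  (* A measure agreeing with the product measure on rectangles equals it; on rectangles this is
     [indep]. *)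
  by apply: product_measure_unique => A1 A2 mA1 mA2; rewrite -indep.
have intf : lam.-integrable setT f.
  by apply: integrable_pushforward => //; exact/Lfun1_integrable.
have intf' : (mu \x nu)%E.-integrable setT f.
  apply/integrableP; split => //; have /integrableP[_] := intf.
  by congr (_ < _)%E; apply: eq_measure_integral => A mA _; exact/esym/joint.
have iX : mu.-integrable setT (EFin : R -> \bar R).
  by apply: integrable_pushforward => //; exact/Lfun1_integrable.
have iY : nu.-integrable setT (EFin : R -> \bar R).
  by apply: integrable_pushforward => //; exact/Lfun1_integrable.
have -> : ('E_P[X] = \int[mu]_x x%:E)%E.
  by rewrite integral_distribution ?expectation_def//; exact/Lfun1_integrable.
have -> : ('E_P[Y] = \int[nu]_x x%:E)%E.
  by rewrite integral_distribution ?expectation_def//; exact/Lfun1_integrable.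
transitivity (\int[mu \x nu]_z f z)%E.
  transitivity (\int[lam]_z f z)%E.
    by rewrite unlock integral_pushforward//; exact/Lfun1_integrable.
  by apply: eq_measure_integral => A mA _; exact/esym/joint.
rewrite -integral12_prod_meas1// /fubini_F/=.
transitivity (\int[mu]_x (x%:E * \int[nu]_y y%:E))%E.
  by apply: eq_integral => x _; rewrite -integralZl.
by rewrite -(fineK (integrable_fin_num measurableT iY)) integralZr.
Qed.

End moments.

(** * Covariance of linear combinations of uncorrelated variables *)

Section uncorrelated.
Context {d} {T : measurableType d} {R : realType} (P : probability T R).
Implicit Types (X Y : T -> R).

Lemma mutually_independent_pair {I : eqType} (Z : I -> {RV P >-> R}) i j :
  mutually_independent P Z -> i != j ->
  forall A B, measurable A -> measurable B ->
  (P (Z i @^-1` A `&` Z j @^-1` B) = P (Z i @^-1` A) * P (Z j @^-1` B))%E.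
Proof.
move=> indep ij A B mA mB.
have mZ k C : measurable C -> measurable (Z k @^-1` C).
  by move=> mC; rewrite -[X in measurable X]setTI; apply: measurable_funP.
have ji : (j == i) = false by rewrite eq_sym (negbTE ij).
have := indep [:: i; j] (fun k => if k == i then A else B).
rewrite /= inE ij => /(_ isT) /= iP.
have {iP} := iP (fun k => ltac:(by case: (k == i))).
rewrite !big_cons big_nil mulr1 eqxx ji => iP.
have capE : \bigcap_(k in [set` [:: i; j]]) (Z k @^-1` (if k == i then A else B))
    = Z i @^-1` A `&` Z j @^-1` B.
  rewrite predeqE => w; split => /= [AB|[Aw Bw] k]; last first.
    by rewrite /= !inE => /orP[]/eqP ->; rewrite ?eqxx ?ji.
  split.
    by have := AB i; rewrite /= eqxx inE eqxx; exact.
  by have := AB j; rewrite /= ji !inE eqxx orbT; exact.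
rewrite capE in iP.
rewrite -[LHS]fineK ?iP ?EFinM ?fineK ?fin_num_measure//; try exact: mZ.
by apply: measurableI; exact: mZ.
Qed.

Lemma covariance_suml (I : Type) (r : seq I) (F : I -> T -> R) Y :
  (forall i, F i \in Lfun P 2%:E) -> Y \in Lfun P 2%:E ->
  (covariance P (\sum_(i <- r) F i)%R Y = \sum_(i <- r) covariance P (F i) Y)%E.
Proof.
move=> F2 Y2; elim: r => [|i r IHr]; first by rewrite !big_nil covariance_cst_l.
by rewrite !big_cons covarianceDl ?IHr// rpred_sum// ?lee1n.
Qed.

(** By bilinearity the covariance is a double sum in which only the diagonal terms survive. *)
Lemma covariance_uncorrelated (I : finType) (Z : I -> T -> R) (V : R) (u v : I -> R) :
  (forall i, Z i \in Lfun P 2%:E) ->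
  (forall i j, covariance P (Z i) (Z j) = (if i == j then V else 0)%:E) ->
  covariance P (\sum_i u i \o* Z i) (\sum_i v i \o* Z i) =
    (V * \sum_i u i * v i)%:E.
Proof.
move=> Z2 covZ.
have Pfin : P setT \is a fin_num := fin_num_measure P _ measurableT.
have sZ2 (a : I -> R) i : a i \o* Z i \in Lfun P 2%:E by rewrite Lfun_scale ?ler1n.
have Z1 i := Lfun_subset12 Pfin (Z2 i).
have sZ1 (a : I -> R) i := Lfun_subset12 Pfin (sZ2 a i).
rewrite covariance_suml ?rpred_sum ?lee1n// mulr_sumr -sumEFin.
apply: eq_bigr => i _.
rewrite covarianceC covariance_suml// (bigD1 i)//= big1 ?adde0 => [|j ji].
  rewrite covarianceZl ?covarianceZr// ?Lfun2_mul_Lfun1//.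
  by rewrite covZ eqxx -!EFinM; congr EFin; lra.
rewrite covarianceZl ?covarianceZr// ?Lfun2_mul_Lfun1//.
by rewrite covZ (negbTE ji) !mule0.
Qed.

End uncorrelated.

(** * Covariances of network outputs *)

Section network.
Context {d} {T : measurableType d} {R : realType} (P : probability T R).
Context {H s : nat} (X : {ffun 'I_H -> 'I_s} * nat -> {RV P >-> R}).
Context (q rho : R) (w : 'I_s -> R).

Definition path_weight (a : {ffun 'I_H -> 'I_s}) : R :=
  q * rho * \prod_(k < H) w (a k).

(** Padding with zeros up to a common bound [N] turns outputs with different path counts into linear
    combinations of one finite family. *)
Definition path_coef (n : {ffun 'I_H -> 'I_s} -> nat) (N : nat)
    (p : {ffun 'I_H -> 'I_s} * 'I_N) : R :=
  if (p.2 < n p.1)%N then path_weight p.1 else 0.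

Lemma Yout_sumE (n : {ffun 'I_H -> 'I_s} -> nat) (N : nat) :
  (forall a, n a <= N)%N ->
  Yout P X q rho w n =
  \sum_(p : {ffun 'I_H -> 'I_s} * 'I_N) path_coef n N p \o* X (p.1, val p.2).
Proof.
move=> nN; apply/funext => om; rewrite /Yout fct_sumE mulr_sumr.
rewrite -(pair_bigA _ (fun a (j : 'I_N) => (path_coef n N (a, j) \o* X (a, val j)) om))/=.
apply: eq_bigr => a _; rewrite (big_ord_widen _ (fun j =>
  X (a, j) om * rho * \prod_(k < H) w (a k)) (nN a)) mulr_sumr.
rewrite big_mkcond; apply: eq_bigr => j _; rewrite /path_coef /=.
by case: ifP => _; rewrite ?mulr0// /path_weight; lra.
Qed.

(** Both coefficients at [(a, j)] come from their counts exactly when [j] is below both [n a] and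
    [n' a]; this is the source of the minimum. *)
Lemma sum_path_coefM (n n' : {ffun 'I_H -> 'I_s} -> nat) (N : nat) :
  (forall a, n a <= N)%N ->
  \sum_p path_coef n N p * path_coef n' N p =
  \sum_a path_weight a ^+ 2 * (minn (n a) (n' a))%:R.
Proof.
move=> nN.
rewrite -(pair_bigA _
  (fun a (j : 'I_N) => path_coef n N (a, j) * path_coef n' N (a, j)))/=.
apply: eq_bigr => a _.
rewrite (eq_bigr (fun j : 'I_N =>
    if (j < minn (n a) (n' a))%N then path_weight a ^+ 2 else 0)) => [|j _].
  have le_N : (minn (n a) (n' a) <= N)%N by rewrite geq_min nN.
  rewrite -big_mkcond -(big_ord_widen _ (fun=> path_weight a ^+ 2) le_N).
  by rewrite sumr_const card_ord mulr_natr.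
rewrite /path_coef/= leq_min.
by case: ifP => _; case: ifP => _; rewrite ?mulr0 ?mul0r// expr2.
Qed.

Lemma covariance_std_normal_indep i j :
  (forall i, std_normal_RV P (X i)) -> mutually_independent P X ->
  covariance P (X i) (X j) = (if i == j then std_normal_var R else 0)%:E.
Proof.
move=> nX indepX; have [<-|ij] := eqVneq i j.
  by rewrite -/('V_P[X i])%E variance_std_normal.
have X2 k := std_normal_Lfun2 P (X k) (nX k).
have Pfin : P setT \is a fin_num := fin_num_measure P _ measurableT.
have X1 k := Lfun_subset12 Pfin (X2 k).
have XX1 := Lfun2_mul_Lfun1 (X2 i) (X2 j).
rewrite covarianceE// expectationM_indep//.
  by rewrite subee// fin_numM// expectation_fin_num.
exact: mutually_independent_pair.
Qed.

Lemma covariance_Yout (n n' : {ffun 'I_H -> 'I_s} -> nat) :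
  (forall i, std_normal_RV P (X i)) -> mutually_independent P X ->
  covariance P (Yout P X q rho w n) (Yout P X q rho w n') =
  (std_normal_var R *
   \sum_a path_weight a ^+ 2 * (minn (n a) (n' a))%:R)%:E.
Proof.
move=> nX indepX; pose N := (\max_a maxn (n a) (n' a))%N.
have nN a : (n a <= N)%N.
  by apply: leq_trans (leq_bigmax a); rewrite leq_maxl.
have n'N a : (n' a <= N)%N.
  by apply: leq_trans (leq_bigmax a); rewrite leq_maxr.
rewrite (Yout_sumE _ _ nN) (Yout_sumE _ _ n'N).
rewrite (@covariance_uncorrelated _ _ _ _ _ _ (std_normal_var R)).
- by rewrite sum_path_coefM.
- by move=> i; exact: std_normal_Lfun2.
- by move=> [a j] [b k]; rewrite covariance_std_normal_indep.
Qed.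

End network.

Theorem theorem3p3 (R : realType) (d : measure_display) (T : measurableType d)
    (P : probability T R)
    (H s Psi : nat) (q rho c : R) (w : 'I_s -> R)
    (X : {ffun 'I_H -> 'I_s} * nat -> {RV P >-> R})
    (t : {ffun 'I_H -> 'I_s} -> nat) :
  (0 < H)%N -> (0 < s)%N -> (0 < Psi)%N -> (s ^ H %| Psi)%N ->
  0 < q -> 0 < rho -> rho <= 1 ->
  (exists i, w i != 0) ->
  (forall i, std_normal_RV P (X i)) ->
  mutually_independent P X ->
  (\sum_(a : {ffun 'I_H -> 'I_s}) t a)%N = Psi ->
  1 <= c ->
  (forall a : {ffun 'I_H -> 'I_s},
      c^-1 * (Psi %/ s ^ H)%:R <= (t a)%:R /\
      (t a)%:R <= c * (Psi %/ s ^ H)%:R) ->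
  corr P (Yout P X q rho w (fun _ => (Psi %/ s ^ H)%N)) (Yout P X q rho w t)
    >= 1 / c ^+ 2.
Proof.
move=> _ s0 Psi0 dvd q0 rho0 _ [i wi0] nX indepX _ c1 tm.
have V0 := std_normal_var_gt0 P (X ([ffun=> i], 0%N)) (nX _).
have covY n n' := covariance_Yout P X q rho w n n' nX indepX.
set V := std_normal_var R in V0 covY.
have c0 : 0 < c by lra.
set m := (Psi %/ s ^ H)%N in tm *.
have m0 : 0 < m%:R :> R.
  by rewrite ltr0n divn_gt0 ?expn_gt0 ?s0//; exact: dvdn_leq.
pose G : R := \sum_(a : {ffun 'I_H -> 'I_s}) path_weight q rho w a ^+ 2.
(* The constant path through [i] has nonzero weight because [w i != 0]; this keeps both standard
   deviations positive. *)
have G0 : 0 < G.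
  rewrite /G (bigD1 [ffun=> i])//= ltr_pwDl//; last first.
    by apply: sumr_ge0 => a _; exact: sqr_ge0.
  have w0 : \prod_(k < H) w ([ffun=> i] k) != 0.
    by apply/prodf_neq0 => k _; rewrite ffunE.
  by rewrite exprn_even_gt0//= !mulf_neq0// gt_eqF.
(* A variance is a covariance of an output with itself, so [covY] evaluates numerator and
   denominator alike. *)
rewrite /corr /variance !covY /=.
under [X in Num.sqrt (V * X) * _]eq_bigr do rewrite minnn.
under [X in _ * Num.sqrt (V * X)]eq_bigr do rewrite minnn.
rewrite -mulr_suml -/G.
set S12 := \sum_a _ * (minn _ _)%:R; set S22 := \sum_a _.
have S12_ge : c^-1 * (G * m%:R) <= S12.
  rewrite mulrCA /S12 mulr_suml; apply: ler_sum => a _.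
  rewrite ler_wpM2l ?sqr_ge0//; have [tm_a _] := tm a.
  (* If the minimum is [t a], the lower uniformity bound applies; if it is [m], then [c^-1 <= 1]
     suffices. *)
  rewrite /minn; case: ifP => // _.
  by rewrite ler_piMl ?(ltW m0)// invf_le1.
have S22_le : S22 <= c * (G * m%:R).
  rewrite mulrCA /S22 mulr_suml; apply: ler_sum => a _.
  by rewrite ler_wpM2l ?sqr_ge0//; case: (tm a).
have S22_gt0 : 0 < S22.
  apply: (@lt_le_trans _ _ S12); last first.
    by apply: ler_sum => a _; rewrite ler_wpM2l ?sqr_ge0// ler_nat geq_minr.
  by apply: lt_le_trans S12_ge; rewrite !mulr_gt0// invr_gt0.
have GV0 : 0 < V * (G * m%:R) by rewrite !mulr_gt0.
rewrite ler_pdivlMr ?mulr_gt0 ?sqrtr_gt0 ?mulr_gt0//.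
(* The bound on [S22] yields the factor [Num.sqrt c]; it is relaxed to [c] through [c <= c ^+ 2],
   which is where the exponent 3/2 becomes 2. *)
have sqrt_le : Num.sqrt (V * S22) <= c * Num.sqrt (V * (G * m%:R)).
  rewrite -[X in X * Num.sqrt _](ger0_norm (ltW c0)) -sqrtr_sqr -sqrtrM ?sqr_ge0//.
  rewrite ler_sqrt ?(mulr_ge0 (sqr_ge0 c) (ltW GV0))//.
  rewrite mulrCA ler_wpM2l ?(ltW V0)//.
  apply: le_trans S22_le _; rewrite ler_wpM2r ?mulr_ge0 ?(ltW G0) ?(ltW m0)//.
  by rewrite expr2 ler_peMl// ltW.
(* The product of the standard deviations is at most [c * (V * (G * m%:R))]; dividing by [c ^+ 2]
   leaves exactly [V] times the lower bound in [S12_ge]. *)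
apply: (@le_trans _ _ (1 / c ^+ 2 * (c * (V * (G * m%:R))))).
  rewrite ler_wpM2l ?divr_ge0 ?sqr_ge0//.
  rewrite -[X in _ <= c * X](sqr_sqrtr (ltW GV0)) expr2 [leRHS]mulrCA.
  by rewrite ler_wpM2l ?sqrtr_ge0.
have -> : 1 / c ^+ 2 * (c * (V * (G * m%:R))) = V * (c^-1 * (G * m%:R)).
  by field; rewrite gt_eqF.
by rewrite ler_wpM2l ?(ltW V0).
Qed.
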